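(* The Schwarzian of a fanning frame $\mathcal{A}(t)$ of $2n\times n$ matrices satisfies the following properties: 1. If $\mathbf{T}$ is an invertible linear transformation from $\mathbb{R}^{2n}$ to itself, $\{\mathbf{T}\mathcal{A}(t),t\}=\{\mathcal{A}(t),t\}$. 2. If $X(t)$ is a smooth curve of invertible $n\times n$ matrices, $\{\mathcal{A}(t)X(t),t\}=X(t)^{-1}\{\mathcal{A}(t),t\}X(t)$. 3. If $s$ is a diffeomorphism of the real line, $\{\mathcal{A}(s(t)),t\}=\{\mathcal{A}(s(t)),s\}\,\dot s(t)^2+\{s(t),t\}\,I$, where $\{\mathcal{A}(s(t)),s\}$ denotes the Schwarzian of $\mathcal{A}$ (with respect to its own parameter) evaluated at $s(t)$.
   Context: A fanning frame is a smooth curve $\mathcal{A}(t)$, $t\in\mathbb{R}$, of real $2n\times n$ matrices such that the $2n\times 2n$ matrix $(\mathcal{A}(t)|\dot{\mathcal{A}}(t))$ obtained by juxtaposition is invertible for all $t$. There are then unique smooth curves of $n\times n$ matrices $P(t),Q(t)$ with $\ddot{\mathcal{A}}+\dot{\mathcal{A}}P(t)+\mathcal{A}Q(t)=O$, and the Schwarzian of $\mathcal{A}(t)$ is $\{\mathcal{A}(t),t\}=2Q(t)-\tfrac12P(t)^2-\dot P(t)$. For a real-valued function $s$, $\{s(t),t\}=\dddot{s}/\dot s-\tfrac32(\ddot s/\dot s)^2$ is the usual Schwarzian derivative. *)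

(* Defs.v *)
From HB Require Import structures.
From mathcomp Require Import all_boot all_order all_algebra.
From mathcomp Require Import all_classical all_reals all_analysis.

Set Implicit Arguments.
Unset Strict Implicit.
Unset Printing Implicit Defensive.

Import Order.TTheory GRing.Theory Num.Theory.
Import numFieldNormedType.Exports.

Local Open Scope classical_set_scope.
Local Open Scope ring_scope.

Definition smooth (R : realType) (V : normedModType R) (f : R -> V) : Prop :=
  forall (k : nat) (t : R), derivable (derive1n k f) t 1.

Definition diffeomorphism (R : realType) (s : R -> R) : Prop :=
  smooth s /\ exists r : R -> R, [/\ smooth r, cancel s r & cancel r s].

(* 2n is written n + n, the width of row_mx (A t) (derive1 A t) *)
Definition fanning_frame (R : realType) (n : nat)
    (A : R -> 'M[R]_(n + n, n)) : Prop :=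
  smooth A /\ forall t, row_mx (A t) (derive1 A t) \in unitmx.

Definition frame_equation (R : realType) (n : nat) (A : R -> 'M[R]_(n + n, n)) :
    set ((R -> 'M[R]_n) * (R -> 'M[R]_n)) :=
  [set PQ | [/\ smooth PQ.1, smooth PQ.2 &
    forall t, derive1n 2 A t + derive1 A t *m PQ.1 t + A t *m PQ.2 t = 0]].

(* When A is a fanning frame, frame_equation A is a singleton and get returns
   its element; when frame_equation A is empty, get returns a default value. *)
Definition frame_coef (R : realType) (n : nat) (A : R -> 'M[R]_(n + n, n)) :
    (R -> 'M[R]_n) * (R -> 'M[R]_n) :=
  get (frame_equation A).

Definition schwarzian (R : realType) (n : nat) (A : R -> 'M[R]_(n + n, n))
    (t : R) : 'M[R]_n :=
  let P := (frame_coef A).1 in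
  let Q := (frame_coef A).2 in
  2 *: Q t - 2^-1 *: (P t *m P t) - derive1 P t.

Definition real_schwarzian (R : realType) (s : R -> R) (t : R) : R :=
  derive1n 3 s t / derive1 s t - 3 / 2 * (derive1n 2 s t / derive1 s t) ^+ 2.

(* Main.v *)
(* Since (A | A') is invertible, the pair (P, Q) is uniquely determined and
   smooth, so the Schwarzian can be computed from any pair solving the frame
   equation. For each of T A, A X and A(s) such a pair is written down explicitly
   in terms of (P, Q), and what remains is an algebraic identity. *)

Require Import Defs.
From HB Require Import structures.
From mathcomp Require Import all_boot all_order all_algebra.
From mathcomp Require Import all_classical all_reals all_analysis.
From mathcomp Require Import ring lra.

Set Implicit Arguments.
Unset Strict Implicit.
Unset Printing Implicit Defensive.

Import Order.TTheory GRing.Theory Num.Theory.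
Import numFieldNormedType.Exports.

Local Open Scope ring_scope.

(** * Derivatives of matrix-valued curves, reduced to entries *)

Lemma derive1_val (R : realType) (V : normedModType R) (f : R -> V) (t : R) d :
  is_derive t 1 f d -> derive1 f t = d.
Proof. by move=> h; rewrite derive1E derive_val. Qed.

Lemma derivable_is_derive (R : realType) (V : normedModType R) (f : R -> V) (t : R) :
  derivable f t 1 -> is_derive t 1 f (derive1 f t).
Proof. by rewrite derive1E => /derivableP. Qed.

(** The bridge to scalar calculus: each matrix rule below is read off from the rule for real
    functions at every entry. *)
Lemma is_derive_mxP (R : realType) m n (M : R -> 'M[R]_(m, n)) (t : R) D :
  is_derive t 1 M D <-> forall i j, is_derive t 1 (fun u => M u i j) (D i j).
Proof.
split=> [h i j | h].
  have dM : derivable M t 1 by [].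
  apply: DeriveDef; first by move/derivable_mxP: dM.
  by rewrite -(@derive_val _ _ _ _ _ _ _ h) derive_mx// mxE.
have dM : derivable M t 1 by apply/derivable_mxP => i j; have [] := h i j.
apply: DeriveDef => //; rewrite derive_mx//; apply/matrixP => i j.
by rewrite mxE derive_val.
Qed.

Lemma derive1_mx (R : realType) m n (M : R -> 'M[R]_(m, n)) (t : R) i j :
  derivable M t 1 -> derive1 M t i j = derive1 (fun u => M u i j) t.
Proof.
by move=> /derivable_is_derive/is_derive_mxP/(_ i j)/derive1_val ->.
Qed.

Lemma is_derive_mulmx (R : realType) m n p
    (M : R -> 'M[R]_(m, n)) (N : R -> 'M[R]_(n, p)) (t : R) DM DN :
  is_derive t 1 M DM -> is_derive t 1 N DN ->
  is_derive t 1 (fun u => M u *m N u) (DM *m N t + M t *m DN).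
Proof.
move=> /is_derive_mxP hM /is_derive_mxP hN; apply/is_derive_mxP => i j.
rewrite (_ : (fun u => _) = \sum_k (fun u => M u i k * N u k j)); last first.
  by apply/funext => u; rewrite mxE fct_sumE.
rewrite !mxE -big_split /=.
suff h k : is_derive t 1 (fun u => M u i k * N u k j)
    (DM i k * N t k j + M t i k * DN k j) by exact: is_derive_sum.
apply: (is_derive_eq (is_deriveM (hM i k) (hN k j))).
by rewrite /GRing.scale /= addrC; congr (_ + _); rewrite mulrC.
Qed.

Lemma is_derive_scalemx (R : realType) m n
    (a : R -> R) (M : R -> 'M[R]_(m, n)) (t : R) da DM :
  is_derive t 1 a da -> is_derive t 1 M DM ->
  is_derive t 1 (fun u => a u *: M u) (da *: M t + a t *: DM).
Proof.
move=> ha /is_derive_mxP hM; apply/is_derive_mxP => i j.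
rewrite (_ : (fun u => _) = (fun u => a u * M u i j)); last first.
  by apply/funext => u; rewrite mxE.
apply: (is_derive_eq (is_deriveM ha (hM i j))).
by rewrite !mxE /GRing.scale /=; ring.
Qed.

Lemma is_derive_mx_comp (R : realType) m n (M : R -> 'M[R]_(m, n)) (s : R -> R)
    (t : R) ds DM :
  is_derive t 1 s ds -> is_derive (s t) 1 M DM ->
  is_derive t 1 (fun u => M (s u)) (ds *: DM).
Proof.
move=> hs /is_derive_mxP hM; apply/is_derive_mxP => i j.
apply: (is_derive_eq (is_derive1_comp (hM i j) hs)).
by rewrite mxE mulrC.
Qed.

(** * Differentiability to order [k] and its closure properties *)

Fixpoint times_derivable (R : realType) (V : normedModType R) (k : nat)
    (f : R -> V) : Prop :=
  if k is k'.+1 then (forall t, derivable f t 1) /\ times_derivable k' (derive1 f)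
  else True.

Section TimesDerivable.
Context {R : realType}.

(** [derive1n] differentiates from the outside, [times_derivable] from the inside. The second form
    suits induction on [k]: [derive1 f] is rewritten by a calculus rule and the induction hypothesis
    applies to its ingredients. *)
Lemma smoothP (V : normedModType R) (f : R -> V) :
  smooth f <-> forall k, times_derivable k f.
Proof.
split=> [sf k | h k t].
  elim: k f sf => //= k ih f sf; split; first exact: (sf 0%N).
  by apply: ih => j t; rewrite -derive1Sn; exact: sf.
elim: k f h => [|k ih] f h; first by have [] := h 1%N.
by rewrite derive1Sn; apply: ih => j; have [] := h j.+1.
Qed.

Lemma times_derivableW (V : normedModType R) k (f : R -> V) :
  times_derivable k.+1 f -> times_derivable k f.
Proof. by elim: k f => //= k ih f [df /ih]. Qed.

Lemma times_derivable_cst (V : normedModType R) k (c : V) :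
  times_derivable k (fun _ : R => c).
Proof.
elim: k c => //= k ih c; split=> [t|]; first exact: derivable_cst.
rewrite (_ : derive1 _ = (fun=> 0)) //.
by apply/funext => t; rewrite derive1_cst.
Qed.

Lemma times_derivableD (V : normedModType R) k (f g : R -> V) :
  times_derivable k f -> times_derivable k g ->
  times_derivable k (fun t => f t + g t).
Proof.
elim: k f g => //= k ih f g [df sf] [dg sg].
split=> [t|]; first exact: derivableD.
rewrite (_ : derive1 _ = (fun t => derive1 f t + derive1 g t)); first exact: ih.
apply/funext => t; apply: derive1_val.
by apply: is_deriveD; exact: derivable_is_derive.
Qed.

(** In [f g' + g f'] the undifferentiated factors reappear; [times_derivableW] lowers their order to
    [k]. *)
Lemma times_derivableM k (f g : R -> R) :
  times_derivable k f -> times_derivable k g ->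
  times_derivable k (fun t => f t * g t).
Proof.
elim: k f g => //= k ih f g [df sf] [dg sg].
split=> [t|]; first exact: derivableM.
rewrite (_ : derive1 _ = (fun t => f t * derive1 g t + g t * derive1 f t)).
  apply: (@times_derivableD _ _ (fun t => f t * derive1 g t)
    (fun t => g t * derive1 f t)).
    by apply: ih => //; apply: times_derivableW (conj df sf).
  by apply: ih => //; apply: times_derivableW (conj dg sg).
apply/funext => t; apply: derive1_val.
by apply: is_deriveM; exact: derivable_is_derive.
Qed.

Lemma times_derivable_sum k (I : Type) (r : seq I) (P : pred I)
    (f : I -> R -> R) : (forall i, times_derivable k (f i)) ->
  times_derivable k (fun t => \sum_(i <- r | P i) f i t).
Proof.
move=> h; rewrite -fct_sumE.
apply: (big_ind (times_derivable k)) => //; first exact: times_derivable_cst.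
by move=> ? ?; exact: times_derivableD.
Qed.

Lemma times_derivable_prod k (I : Type) (r : seq I) (P : pred I)
    (f : I -> R -> R) : (forall i, times_derivable k (f i)) ->
  times_derivable k (fun t => \prod_(i <- r | P i) f i t).
Proof.
move=> h; elim: r => [|i r ih].
  rewrite (_ : (fun t => _) = fun=> 1); first exact: times_derivable_cst.
  by apply/funext => t; rewrite big_nil.
under eq_fun do rewrite big_cons; case: (P i) => //.
exact: times_derivableM.
Qed.

(** The derivative [- f^-1 f^-1 f'] contains [f^-1] again, so the induction is on [k] with [f] fixed
    and the product rule does the rest. *)
Lemma times_derivableV k (f : R -> R) : (forall t, f t != 0) ->
  times_derivable k f -> times_derivable k (fun t => (f t)^-1).
Proof.
move=> f0; elim: k => //= k ih sf; have [df sf'] := sf.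
split=> [t|]; first exact: derivableV.
rewrite (_ : derive1 _ = (fun t => -1 * ((f t)^-1 * (f t)^-1 * derive1 f t))).
  apply: times_derivableM; first exact: times_derivable_cst.
  have fV := ih (@times_derivableW _ k f sf).
  by do 2!apply: times_derivableM => //.
apply/funext => t; rewrite derive1E deriveV // -derive1E.
by rewrite /GRing.scale /= mulN1r mulNr expr2 invfM.
Qed.

Lemma times_derivable_comp k (f s : R -> R) :
  times_derivable k f -> times_derivable k s ->
  times_derivable k (fun t => f (s t)).
Proof.
elim: k f s => //= k ih f s [df sf] ss; have [ds ss'] := ss.
have D (t : R) : is_derive t 1 (fun u => f (s u)) (derive1 f (s t) * derive1 s t).
  by apply: is_derive1_comp; exact: derivable_is_derive.
split=> [t|]; first by [].
rewrite (_ : derive1 _ = (fun t => derive1 f (s t) * derive1 s t)).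
  apply: times_derivableM => //; apply: ih => //.
  exact: (@times_derivableW _ k s ss).
by apply/funext => t; exact: derive1_val.
Qed.

Lemma times_derivable_mxP m n k (M : R -> 'M[R]_(m, n)) :
  times_derivable k M <-> forall i j, times_derivable k (fun t => M t i j).
Proof.
elim: k M => //= k ih M; split.
  move=> [dM /ih sM] i j; split; first by move=> t; move: (dM t) => /derivable_mxP.
  rewrite (_ : derive1 _ = (fun t => derive1 M t i j)) //.
  by apply/funext => t; rewrite derive1_mx.
move=> h; have dM (t : R) : derivable M t 1.
  by apply/derivable_mxP => i j; have [] := h i j.
split=> //; apply/ih => i j; rewrite (_ : (fun t => _) = derive1 (fun t => M t i j)).
  by have [] := h i j.
by apply/funext => t; rewrite derive1_mx.
Qed.

End TimesDerivable.

(** * Smooth curves: closure properties and differentiation rules *)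

Section Smooth.
Context {R : realType}.

Lemma smooth_derivable (V : normedModType R) (f : R -> V) (t : R) :
  smooth f -> derivable f t 1.
Proof. by move=> /(_ 0%N). Qed.

Lemma smooth_is_derive (V : normedModType R) (f : R -> V) (t : R) :
  smooth f -> is_derive t 1 f (derive1 f t).
Proof. by move=> sf; apply: derivable_is_derive; exact: smooth_derivable. Qed.

Lemma smooth_derive1 (V : normedModType R) (f : R -> V) :
  smooth f -> smooth (derive1 f).
Proof. by move=> sf k t; rewrite -derive1Sn. Qed.

Local Opaque smooth.

Lemma smooth_cst (V : normedModType R) (c : V) : smooth (fun _ : R => c).
Proof. by apply/smoothP => k; exact: times_derivable_cst. Qed.

Lemma smoothD (V : normedModType R) (f g : R -> V) :
  smooth f -> smooth g -> smooth (fun t => f t + g t).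
Proof.
move=> /smoothP sf /smoothP sg.
by apply/smoothP => k; exact: times_derivableD.
Qed.

Lemma smoothM (f g : R -> R) :
  smooth f -> smooth g -> smooth (fun t => f t * g t).
Proof.
move=> /smoothP sf /smoothP sg.
by apply/smoothP => k; exact: times_derivableM.
Qed.

Lemma smoothV (f : R -> R) :
  (forall t, f t != 0) -> smooth f -> smooth (fun t => (f t)^-1).
Proof.
by move=> f0 /smoothP sf; apply/smoothP => k; exact: times_derivableV.
Qed.

Lemma smooth_mxP m n (M : R -> 'M[R]_(m, n)) :
  smooth M <-> forall i j, smooth (fun t => M t i j).
Proof.
split=> [/smoothP sM i j | sM]; apply/smoothP => k.
  by move/times_derivable_mxP: (sM k).
by apply/times_derivable_mxP => i j; move/smoothP: (sM i j).
Qed.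

Lemma smooth_scalemx m n (a : R -> R) (M : R -> 'M[R]_(m, n)) :
  smooth a -> smooth M -> smooth (fun t => a t *: M t).
Proof.
move=> sa /smooth_mxP sM; apply/smooth_mxP => i j.
rewrite (_ : (fun t => _) = (fun t => a t * M t i j)).
  exact: (@smoothM a (fun t => M t i j) sa (sM i j)).
by apply/funext => t; rewrite mxE.
Qed.

Lemma smoothN_mx m n (M : R -> 'M[R]_(m, n)) :
  smooth M -> smooth (fun t => - M t).
Proof.
move=> sM; under eq_fun do rewrite -scaleN1r.
by apply: smooth_scalemx => //; exact: smooth_cst.
Qed.

Lemma smooth_mulmx m n p (M : R -> 'M[R]_(m, n)) (N : R -> 'M[R]_(n, p)) :
  smooth M -> smooth N -> smooth (fun t => M t *m N t).
Proof.
move=> /smooth_mxP sM /smooth_mxP sN; apply/smooth_mxP => i j.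
under eq_fun do rewrite mxE.
apply/smoothP => k; apply: times_derivable_sum => l.
by apply/smoothP: k; exact: smoothM.
Qed.

Lemma smooth_comp (f s : R -> R) :
  smooth f -> smooth s -> smooth (fun t => f (s t)).
Proof.
move=> /smoothP sf /smoothP ss.
by apply/smoothP => k; exact: times_derivable_comp.
Qed.

Lemma smooth_mx_comp m n (M : R -> 'M[R]_(m, n)) (s : R -> R) :
  smooth M -> smooth s -> smooth (fun t => M (s t)).
Proof.
move=> /smooth_mxP sM ss; apply/smooth_mxP => i j.
exact: (@smooth_comp (fun t => M t i j) s (sM i j) ss).
Qed.

(** By the Leibniz formula the determinant is a signed sum of products of entries. *)
Lemma smooth_det n (M : R -> 'M[R]_n) :
  smooth M -> smooth (fun t => \det (M t)).
Proof.
move=> /smooth_mxP sM; apply/smoothP => k; apply: times_derivable_sum => p.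
apply: times_derivableM; first exact: times_derivable_cst.
apply: (@times_derivable_prod R k _ _ _ (fun i t => M t i (perm.fun_of_perm p i))) => i.
by have /smoothP := sM i (perm.fun_of_perm p i).
Qed.

(** Cramer's rule: the inverse is the adjugate over a nowhere vanishing determinant, and cofactors
    are determinants of minors up to sign. *)
Lemma smooth_invmx n (M : R -> 'M[R]_n) : smooth M ->
  (forall t, M t \in unitmx) -> smooth (fun t => invmx (M t)).
Proof.
move=> sM uM; rewrite (_ : (fun t => _) = (fun t => (\det (M t))^-1 *: \adj (M t))).
  apply: smooth_scalemx.
    apply: smoothV; last exact: smooth_det.
    by move=> t; rewrite -unitfE -unitmxE.
  apply/smooth_mxP => i j; under eq_fun do rewrite mxE.
  apply: smoothM; first exact: smooth_cst.
  apply: smooth_det; apply/smooth_mxP => k l; under eq_fun do rewrite !mxE.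
  by move/smooth_mxP: sM; apply.
by apply/funext => t; rewrite /invmx uM.
Qed.

Lemma smooth_row_mx m n p (M : R -> 'M[R]_(m, n)) (N : R -> 'M[R]_(m, p)) :
  smooth M -> smooth N -> smooth (fun t => row_mx (M t) (N t)).
Proof.
move=> /smooth_mxP sM /smooth_mxP sN; apply/smooth_mxP => i j.
by under eq_fun do rewrite mxE; case: splitP => ? _; [apply: sM | apply: sN].
Qed.

Lemma smooth_usubmx m n p (M : R -> 'M[R]_(m + n, p)) :
  smooth M -> smooth (fun t => usubmx (M t)).
Proof.
by move=> /smooth_mxP sM; apply/smooth_mxP => i j; under eq_fun do rewrite mxE; apply: sM.
Qed.

Lemma smooth_dsubmx m n p (M : R -> 'M[R]_(m + n, p)) :
  smooth M -> smooth (fun t => dsubmx (M t)).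
Proof.
by move=> /smooth_mxP sM; apply/smooth_mxP => i j; under eq_fun do rewrite mxE; apply: sM.
Qed.

(** An equality of functions, not of values, so that it can be rewritten under a further [derive1]
    when second derivatives are computed. The next three rules have the same form. *)
Lemma derive1_mulmx m p q (M : R -> 'M[R]_(m, p)) (N : R -> 'M[R]_(p, q)) :
  smooth M -> smooth N -> derive1 (fun u => M u *m N u)
    = (fun u => derive1 M u *m N u + M u *m derive1 N u).
Proof.
move=> sM sN; apply/funext => u; apply: derive1_val.
by apply: is_derive_mulmx; exact: smooth_is_derive.
Qed.

Lemma derive1D_mx m p (M N : R -> 'M[R]_(m, p)) :
  smooth M -> smooth N -> derive1 (fun u => M u + N u)
    = (fun u => derive1 M u + derive1 N u).
Proof.
move=> sM sN; apply/funext => u; apply: derive1_val.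
by apply: is_deriveD; exact: smooth_is_derive.
Qed.

Lemma derive1_scalemx m p (a : R -> R) (M : R -> 'M[R]_(m, p)) :
  smooth a -> smooth M -> derive1 (fun u => a u *: M u)
    = (fun u => derive1 a u *: M u + a u *: derive1 M u).
Proof.
move=> sa sM; apply/funext => u; apply: derive1_val.
by apply: is_derive_scalemx; exact: smooth_is_derive.
Qed.

Lemma derive1_mx_comp m p (M : R -> 'M[R]_(m, p)) (s : R -> R) :
  smooth M -> smooth s -> derive1 (fun u => M (s u))
    = (fun u => derive1 s u *: derive1 M (s u)).
Proof.
move=> sM ss; apply/funext => u; apply: derive1_val.
by apply: is_derive_mx_comp; exact: smooth_is_derive.
Qed.

(** Differentiating [r (s u) = u] gives [r'(s t) s'(t) = 1], which excludes [s'(t) = 0]. *)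
Lemma diffeomorphism_derive1_neq0 (s : R -> R) (t : R) :
  diffeomorphism s -> derive1 s t != 0.
Proof.
move=> [ss [r [sr sK rK]]]; apply/eqP => s0.
have := is_derive1_comp (smooth_is_derive (s t) sr) (smooth_is_derive t ss).
rewrite s0 mulr0 (_ : r \o s = id); last exact/funext.
by move=> /derive1_val/eqP; rewrite derive1E derive_id oner_eq0.
Qed.

End Smooth.

(** * Coefficients of the frame equation and the three transformation laws *)

Section Frames.
Context {R : realType} {n : nat}.
Implicit Types (A : R -> 'M[R]_(n + n, n)) (P Q X : R -> 'M[R]_n).
Local Opaque smooth derive1.

(** Solving the linear system gives [- (A | A')^-1 A'']. Its upper block multiplies [A] and is [Q];
    its lower block multiplies [A'] and is [P]. Smoothness comes from that of the inverse. *)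
Lemma frame_coef_exists A : fanning_frame A -> exists PQ, frame_equation A PQ.
Proof.
move=> [sA uA].
pose M (t : R) := - (invmx (row_mx (A t) (derive1 A t)) *m derive1 (derive1 A) t).
have sM : smooth M.
  apply/smoothN_mx/smooth_mulmx; last exact/smooth_derive1/smooth_derive1.
  exact (smooth_invmx (smooth_row_mx sA (smooth_derive1 sA)) uA).
exists (fun t => dsubmx (M t), fun t => usubmx (M t)); split => /=.
- exact: smooth_dsubmx.
- exact: smooth_usubmx.
- move=> t; rewrite -addrA.
  rewrite [X in _ + X]addrC -mul_row_col vsubmxK.
  by rewrite /M mulmxN mulKVmx // subrr.
Qed.

(** Two solutions give the same product of [(A | A')] with the stacked column of [Q] over [P],
    namely [- A''], and the invertible factor cancels. *)
Lemma frame_coef_unique A P Q :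
  (forall t, row_mx (A t) (derive1 A t) \in unitmx) ->
  frame_equation A (P, Q) -> frame_coef A = (P, Q).
Proof.
move=> uA ePQ; have /= [_ _ E] := ePQ.
(* The given pair shows that the solution set is inhabited, so [get] returns a solution and not its
   default value. *)
have [_ _] : frame_equation A (frame_coef A) by exact: (getPex (ex_intro _ _ ePQ)).
case: (frame_coef A) => P1 Q1 /= E1.
have H t : col_mx (Q1 t) (P1 t) = col_mx (Q t) (P t).
  apply: (can_inj (mulKmx (uA t))); rewrite !mul_row_col.
  apply: (addrI (derive1n 2 A t)).
  by rewrite ![A t *m _ + _]addrC !addrA E E1.
by congr pair; apply/funext => t; have /eq_col_mx[] := H t.
Qed.

(** Each transformation law uses this twice: for [A], and for the transformed curve with an explicit
    pair. *)
Lemma schwarzianE A P Q t :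
  (forall t, row_mx (A t) (derive1 A t) \in unitmx) ->
  frame_equation A (P, Q) ->
  schwarzian A t = 2 *: Q t - 2^-1 *: (P t *m P t) - derive1 P t.
Proof. by move=> uA e; rewrite /schwarzian (frame_coef_unique uA e). Qed.

(** A constant [T] commutes with differentiation, so [T] factors out of the frame equation and the
    same pair [(P, Q)] serves both curves. *)
Lemma schwarzian_mull A (T : 'M[R]_(n + n)) t : fanning_frame A ->
  T \in unitmx -> schwarzian (fun u => T *m A u) t = schwarzian A t.
Proof.
move=> fA uT; have [sA uA] := fA; have [[P Q] e] := frame_coef_exists fA.
have d (B : R -> 'M[R]_(n + n, n)) : smooth B ->
    derive1 (fun u => T *m B u) = (fun u => T *m derive1 B u).
  move=> sB; apply/funext => u; apply: derive1_val.
  have := is_derive_mulmx (is_derive_cst T u 1) (smooth_is_derive u sB).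
  by rewrite mul0mx add0r.
rewrite (schwarzianE t uA e); apply: schwarzianE.
  by move=> u; rewrite (d _ sA) -mul_mx_row unitmx_mul uT uA.
have /= [sP sQ E] := e; split=> /= [||u]; [exact: sP|exact: sQ|].
move: (E u) => /=; rewrite (d _ sA) (d _ (smooth_derive1 sA)).
by move=> Eu; rewrite -!mulmxA -!mulmxDr Eu mulmx0.
Qed.

(* Writing P2, Q2 for the coefficients of A X, the frame equation forces
   X P2 = P X - 2 X' and X Q2 = Q X - X'' - X' P2; differentiating the former
   gives X P2' without differentiating invmx X. *)
Lemma schwarzian_mulr A X t : fanning_frame A -> smooth X ->
  (forall u, X u \in unitmx) ->
  schwarzian (fun u => A u *m X u) t = invmx (X t) *m schwarzian A t *m X t.
Proof.
move=> fA sX uX; have [sA uA] := fA; have [[P Q] e] := frame_coef_exists fA.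
have /= [sP sQ E] := e.
have sA1 := smooth_derive1 sA; have sX1 := smooth_derive1 sX.
have sX2 := smooth_derive1 sX1.
pose P2 u := invmx (X u) *m (P u *m X u + (-2) *: derive1 X u).
pose Q2 u := invmx (X u) *m
  (Q u *m X u + - derive1 (derive1 X) u + - (derive1 X u *m P2 u)).
have sm2 : smooth (fun _ : R => -2 : R) by exact: smooth_cst.
have sR : smooth (fun u => P u *m X u + (-2) *: derive1 X u).
  exact (smoothD (smooth_mulmx sP sX) (smooth_scalemx sm2 sX1)).
have sY : smooth (fun u => invmx (X u)) by exact (smooth_invmx sX uX).
have sP2 : smooth P2 by exact (smooth_mulmx sY sR).
have sQ2 : smooth Q2.
  apply: (smooth_mulmx sY).
  apply: (smoothD _ (smoothN_mx (smooth_mulmx sX1 sP2))).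
  exact (smoothD (smooth_mulmx sQ sX) (smoothN_mx sX2)).
have XP2 u : X u *m P2 u = P u *m X u + (-2) *: derive1 X u by rewrite mulKVmx.
have XQ2 u : X u *m Q2 u
    = Q u *m X u + - derive1 (derive1 X) u + - (derive1 X u *m P2 u).
  by rewrite mulKVmx.
(* From here on only [XP2] and [XQ2] are known about the new coefficients, so no inverse is ever
   expanded. *)
clearbody P2 Q2.
have dB := derive1_mulmx sA sX.
have ddB u : derive1 (derive1 (fun u => A u *m X u)) u =
    derive1 (derive1 A) u *m X u + derive1 A u *m derive1 X u +
    (derive1 A u *m derive1 X u + A u *m derive1 (derive1 X) u).
  rewrite dB (derive1D_mx (smooth_mulmx sA1 sX) (smooth_mulmx sA sX1)).
  by rewrite (derive1_mulmx sA1 sX) (derive1_mulmx sA sX1).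
have XdP2 : derive1 X t *m P2 t + X t *m derive1 P2 t =
    derive1 P t *m X t + P t *m derive1 X t + (-2) *: derive1 (derive1 X) t.
  have := derive1_mulmx sX sP2; rewrite (funext XP2).
  rewrite (derive1D_mx (smooth_mulmx sP sX) (smooth_scalemx sm2 sX1)).
  rewrite (derive1_mulmx sP sX) (derive1_scalemx sm2 sX1).
  by move=> /(congr1 (fun f => f t)) <-; rewrite derive1_cst scale0r add0r.
rewrite (schwarzianE t uA e) (@schwarzianE _ P2 Q2).
(* With [invmx (X t)] factored out of both sides, the new coefficients occur behind [X t], where
   [XP2], [XQ2] and [XdP2] apply. *)
- rewrite -[LHS](mulKmx (uX t)) -mulmxA; congr (_ *m _).
  rewrite !mulmxDr !mulmxN -!scalemxAr mulmxA XP2 XQ2.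
  have -> : X t *m derive1 P2 t = derive1 P t *m X t + P t *m derive1 X t +
      (-2) *: derive1 (derive1 X) t - derive1 X t *m P2 t.
    by rewrite -XdP2 addrAC subrr add0r.
  rewrite mulmxDl -mulmxA XP2 mulmxDr -!scalemxAr -!scalemxAl !mulmxDl !mulNmx.
  rewrite -!scalemxAl !mulmxA.
  (* With the noncommutative products as atoms the identity is linear: the terms in [X''], [X' P2]
     and [P X'] cancel. *)
  move: (Q t *m X t) (derive1 (derive1 X) t) (derive1 X t *m P2 t) => a b c.
  move: (P t *m P t *m X t) (P t *m derive1 X t) (derive1 P t *m X t) => d f g.
  by apply/matrixP => i j; rewrite !mxE; lra.
- move=> u; rewrite dB.
  (* Since [(A X)' = A' X + A X'], the new juxtaposition is the old one times a block triangular
     matrix with [X] twice on the diagonal. *)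
  rewrite (_ : row_mx _ _ = row_mx (A u) (derive1 A u) *m
    block_mx (X u) (derive1 X u) 0 (X u)); last first.
    by rewrite mul_row_block mulmx0 addr0 addrC.
  by rewrite unitmx_mul uA /= unitmxE det_ublock unitrM -!unitmxE uX.
- split=> /= [||u]; [exact: sP2|exact: sQ2|].
  move: (E u) => /=; rewrite ddB dB.
  (* The frame equation of [A] eliminates [A'']; the coefficients of [A'] and [A] then vanish by
     [XP2] and [XQ2]. *)
  rewrite -addrA => /eqP; rewrite addr_eq0 => /eqP ->.
  rewrite mulmxDl -!mulmxA XP2 XQ2 !mulmxDr !mulmxN mulNmx mulmxDl.
  rewrite -!scalemxAr !mulmxA.
  move: (_ *m P u *m X u) (_ *m Q u *m X u) (_ *m derive1 X u) => a b c.
  move: (_ *m derive1 (derive1 X) u) (_ *m derive1 X u *m P2 u) => d f.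
  by apply/matrixP => i j; rewrite !mxE; lra.
Qed.

(* The coefficients of A(s) are s' P(s) - (s''/s') I and s'^2 Q(s). *)
Lemma schwarzian_comp A (s : R -> R) t : fanning_frame A -> diffeomorphism s ->
  schwarzian (fun u => A (s u)) t
    = (derive1 s t) ^+ 2 *: schwarzian A (s t) + (real_schwarzian s t)%:M.
Proof.
move=> fA ds; have [sA uA] := fA; have [[P Q] e] := frame_coef_exists fA.
have /= [sP sQ E] := e; have [ss _] := ds.
have s0 u := diffeomorphism_derive1_neq0 u ds.
have ss1 := smooth_derive1 ss; have ss2 := smooth_derive1 ss1.
have sA1 := smooth_derive1 sA.
(* The logarithmic derivative of [s']; the Schwarzian of [s] is [c' - c^2 / 2]. *)
pose c u := derive1 (derive1 s) u * (derive1 s u)^-1.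
have sc : smooth c by exact (smoothM ss2 (smoothV s0 ss1)).
have cs u : c u * derive1 s u = derive1 (derive1 s) u by rewrite mulfVK.
(* Obtained by differentiating [c s' = s''], which replaces the quotient rule for [c]. *)
have dc : derive1 c t * derive1 s t + c t * derive1 (derive1 s) t
    = derive1 (derive1 (derive1 s)) t.
  rewrite -[in RHS](funext cs); apply/esym/derive1_val.
  apply: (is_derive_eq
    (is_deriveM (smooth_is_derive t sc) (smooth_is_derive t ss1))).
  by rewrite /GRing.scale /=; ring.
(* In [A(s)'' = s'^2 A''(s) + s'' A'(s)] the last term is [c A(s)'], whence the correction
   [- c I]. *)
pose P3 u := derive1 s u *: P (s u) + (- 1) *: (c u *: (1%:M : 'M[R]_n)).
pose Q3 u := derive1 s u *: (derive1 s u *: Q (s u)).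
have sm1 : smooth (fun _ : R => -1 : R) by exact: smooth_cst.
have sI : smooth (fun _ : R => (1%:M : 'M[R]_n)) by exact: smooth_cst.
have scI := smooth_scalemx sc sI.
have sNcI : smooth (fun u => (-1) *: (c u *: (1%:M : 'M[R]_n))).
  exact (smooth_scalemx sm1 scI).
have sPs := smooth_mx_comp sP ss.
have ssP := smooth_scalemx ss1 sPs.
have sP3 : smooth P3 by exact (smoothD ssP sNcI).
have sQ3 : smooth Q3.
  exact (smooth_scalemx ss1 (smooth_scalemx ss1 (smooth_mx_comp sQ ss))).
have dP3 : derive1 P3 t = derive1 (derive1 s) t *: P (s t) +
    derive1 s t *: (derive1 s t *: derive1 P (s t)) - derive1 c t *: 1%:M.
  rewrite (derive1D_mx ssP sNcI) (derive1_scalemx ss1 sPs) (derive1_mx_comp sP ss).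
  rewrite (derive1_scalemx sm1 scI) (derive1_scalemx sc sI).
  by rewrite !derive1_cst scaler0 scale0r add0r addr0 scaleN1r.
have dB := derive1_mx_comp sA ss.
have ddB u : derive1 (derive1 (fun u => A (s u))) u =
    derive1 (derive1 s) u *: derive1 A (s u) +
    derive1 s u *: (derive1 s u *: derive1 (derive1 A) (s u)).
  rewrite dB (derive1_scalemx ss1 (smooth_mx_comp sA1 ss)).
  by rewrite (derive1_mx_comp sA1 ss).
rewrite (schwarzianE (s t) uA e) (@schwarzianE _ P3 Q3).
- rewrite dP3 /P3 /Q3 /real_schwarzian !derive1nS derive1n0.
  rewrite !mulmxDl !mulmxDr -!scalemxAl -!scalemxAr !mulmx1 !mul1mx.
  rewrite -[X in _ = _ + X]scalemx1.
  (* The terms in [P (s t)] cancel because [c s' = s'']. The multiples of the identity add up to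
     [c' - c^2 / 2], which this value of [c'] turns into the Schwarzian of [s]. *)
  have -> : derive1 c t = (derive1 (derive1 (derive1 s)) t
      - c t * derive1 (derive1 s) t) / derive1 s t.
    by rewrite -dc addrK mulfK.
  rewrite /c; move: (P (s t) *m P (s t)) (1%:M) => a b.
  move: (derive1 (derive1 (derive1 s)) t) (derive1 (derive1 s) t) => s3 s2.
  move: (derive1 s t) (s0 t) => s1 s1_neq0.
  move: (P (s t)) (Q (s t)) (derive1 P (s t)) => p q p1.
  by apply/matrixP => i j; rewrite !mxE; field.
- move=> u; rewrite dB.
  (* Since [A(s)' = s' A'(s)], the factor is block diagonal with blocks [I] and [s' I], and its
     determinant is a power of [s']. *)
  rewrite (_ : row_mx _ _ = row_mx (A (s u)) (derive1 A (s u)) *m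
    block_mx 1%:M 0 0 (derive1 s u)%:M); last first.
    by rewrite mul_row_block !mulmx0 addr0 add0r mulmx1 mul_mx_scalar.
  rewrite unitmx_mul uA /= unitmxE det_ublock det1 mul1r det_scalar.
  by rewrite unitrX // unitfE.
- split=> /= [||u]; [exact: sP3|exact: sQ3|].
  have /eqP := E (s u); rewrite /= ddB dB.
  rewrite -addrA addr_eq0 => /eqP ->.
  rewrite /P3 /Q3 mulmxDr -!scalemxAl -!scalemxAr mulmx1 -cs.
  move: (derive1 A (s u) *m P (s u)) (A (s u) *m Q (s u)) => a b.
  move: (derive1 A (s u)) (derive1 s u) => d s1.
  by apply/matrixP => i j; rewrite !mxE; ring.
Qed.

End Frames.

Theorem corollary1p6 (R : realType) (n : nat) (A : R -> 'M[R]_(n + n, n))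
    (hA : fanning_frame A) :
  [/\ (forall T : 'M[R]_(n + n), T \in unitmx ->
        forall t : R, schwarzian (fun u => T *m A u) t = schwarzian A t),
      (forall X : R -> 'M[R]_n, smooth X -> (forall t, X t \in unitmx) ->
        forall t : R, schwarzian (fun u => A u *m X u) t
          = invmx (X t) *m schwarzian A t *m X t)
    & (forall s : R -> R, diffeomorphism s ->
        forall t : R, schwarzian (fun u => A (s u)) t
          = (derive1 s t) ^+ 2 *: schwarzian A (s t) + (real_schwarzian s t)%:M)].
Proof.
split=> [T uT t|X sX uX t|s ds t].
- exact: schwarzian_mull.
- exact: schwarzian_mulr.
- exact: schwarzian_comp.
Qed.
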